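(* Let $p$ be a real polynomial, let $\sigma\in\mathbb{R}$, and put $p_\sigma(z)=p'(z)+\sigma p(z)$. Let $\lambda\in\mathbb{C}$ be a zero of $Q[p_\sigma]$ of multiplicity $r\geqslant 1$ such that $p(\lambda)\neq 0$, $p'(\lambda)\neq 0$ and $p_\sigma(\lambda)\neq 0$. If $Q[p](\lambda)=0$, then $\lambda$ is a zero of $Q[p]$ of multiplicity $r+1$.
   Context: For a polynomial $f$ that is not identically zero, $Q[f]$ denotes the rational function $$Q[f](z)=\frac{d}{dz}\left(\frac{f'(z)}{f(z)}\right)=\frac{f(z)f''(z)-(f'(z))^2}{(f(z))^2}.$$ A zero of multiplicity $r$ means a zero of exact (finite) order $r$. A real polynomial is a polynomial with real coefficients. *)

(* Defs.v *)
From HB Require Import structures.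
From mathcomp Require Import all_boot all_order all_algebra.
From mathcomp Require Import ring.
From mathcomp Require Import generic_quotient fraction reals complex.

Set Implicit Arguments.
Unset Strict Implicit.
Unset Printing Implicit Defensive.

Import GRing.Theory.
Local Open Scope ring_scope.
Local Open Scope quotient_scope.

Notation "{ 'ratfun' F }" := {fraction {poly F}}
  (at level 0, format "{ 'ratfun'  F }") : type_scope.

Local Notation "x %:F" := (@FracField.tofrac _ x).

Section RationalFunctions.
Variable F : fieldType.
Implicit Types (u v f : {poly F}) (g : {ratfun F}) (z c : F).

(* The quotient rule on the chosen representative of g; independence of the
   representative is [ratderivE]. *)
Definition ratderiv g : {ratfun F} :=
  let: u := (frac (repr g)).1 in
  let: v := (frac (repr g)).2 in
  (u^`() * v - u * v^`())%:F / (v ^+ 2)%:F.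

(* False when z is a pole of g. *)
Definition ratvalue g z c : Prop :=
  exists u v, [/\ v.[z] != 0, g = u%:F / v%:F & u.[z] / v.[z] = c].

(* The order of vanishing of g at z is exactly r; never holds for g = 0. *)
Definition zero_of_mult g z (r : nat) : Prop :=
  exists u v, [/\ u != 0, v.[z] != 0, g = u%:F / v%:F & mup z u = r].

Definition Q f : {ratfun F} := ratderiv ((f^`())%:F / f%:F).

Lemma ratfun_repr g :
  g = ((frac (repr g)).1)%:F / ((frac (repr g)).2)%:F.
Proof.
have h := denom_ratioP (repr g).
rewrite -[LHS]reprK; set x := repr g in h *.
apply: (canRL (mulfK _)); first by rewrite tofrac_eq0.
rewrite !piE; apply/eqP; rewrite piE.
rewrite /FracField.equivf /FracField.mulf.
by rewrite !numden_Ratio ?mulf_neq0 ?oner_neq0 // !mulr1 mulrC.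
Qed.

Lemma ratderivE u v : v != 0 ->
  ratderiv (u%:F / v%:F) = (u^`() * v - u * v^`())%:F / (v ^+ 2)%:F.
Proof.
move=> v0; rewrite /ratderiv.
have := ratfun_repr (u%:F / v%:F); set x := repr _.
have w0 := denom_ratioP x.
move: (frac x).1 (frac x).2 w0 => a b b0 /eqP.
rewrite eqr_div ?tofrac_eq0 // -!tofracM tofrac_eq => /eqP e.
have e' : u^`() * b + u * b^`() = a^`() * v + a * v^`() by rewrite -!derivM e.
apply/eqP; rewrite eqr_div ?tofrac_eq0 ?expf_neq0 // -!tofracM tofrac_eq.
rewrite -subr_eq0; apply/eqP.
transitivity ((a^`() * v + a * v^`() - (u^`() * b + u * b^`())) * (b * v)
   - (a * v - u * b) * (b^`() * v + b * v^`())); first by ring.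
by rewrite e' e !subrr !mul0r subrr.
Qed.

Lemma QE f : f != 0 ->
  Q f = (f * f^`(2) - f^`() ^+ 2)%:F / (f ^+ 2)%:F.
Proof.
by move=> f0; rewrite /Q ratderivE // derivSn derivn1 [f * _]mulrC expr2.
Qed.

End RationalFunctions.

Definition cpoly (R : realType) (p : {poly R}) : {poly R[i]} :=
  map_poly (real_complex R) p.

Definition psigma (R : realType) (p : {poly R}) (sigma : R) : {poly R} :=
  p^`() + sigma *: p.

(* Main.v *)
Require Import Defs.
From mathcomp Require Import all_boot all_order all_algebra.
From mathcomp Require Import ring.
From mathcomp Require Import fraction reals complex.

(** Write [Q[f] = L'] with [L = f'/f].  The function [g = f' + s f] equals
    [f (L + s)], so its logarithmic derivative is [L + L'/(L + s)], and
    [Q[g] = Q[f] + (Q[f] / (L + s))'].  At a point where neither [f] nor [g]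
    vanishes, [L + s] is regular and nonzero.  If [Q[f]] has a zero of order
    [m >= 1] there, then so has the quotient [Q[f] / (L + s)]; its derivative
    has order exactly [m - 1] in characteristic zero, and adding [Q[f]], of
    order [m], does not change this.  Hence [Q[g]] vanishes to order [m - 1].
    The order [m] is finite: if [Q[f]] were identically zero, so would be
    [Q[g]].

    The proof is carried out on the numerators [Qnum f = f f'' - f'^2], for
    which clearing denominators gives the polynomial identity [Qnum_shift]:
    [f Qnum(g) = Qnum(f)' g + Qnum(f) (s g - g')].  The order of the right-hand
    side is computed in [mup_deriv_comb]. *)

Set Implicit Arguments.
Unset Strict Implicit.
Unset Printing Implicit Defensive.

Import GRing.Theory.

Local Open Scope ring_scope.

Local Notation "x %:F" := (FracField.tofrac x).

(** The numerator of [Q f] over the denominator [f ^+ 2]. *)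
Definition Qnum (F : fieldType) (f : {poly F}) : {poly F} :=
  f * f^`(2) - f^`() ^+ 2.

Lemma Qnum_shift (F : fieldType) (f : {poly F}) (s : F) :
  let g := f^`() + s *: f in
  f * Qnum g = (Qnum f)^`() * g + Qnum f * (s *: g - g^`()).
Proof.
rewrite /Qnum !derivSn !derivn0 /= !expr2.
rewrite !(derivB, derivM, derivD, derivZ) -!mul_polyC; ring.
Qed.

(** In characteristic zero, differentiation lowers the order of a zero by
    exactly one; multiplying by [g], nonzero at [x], preserves this order, and
    [N * h], which vanishes at least to the order of [N], does not affect it. *)
Lemma mup_deriv_comb (F : fieldType) (N g h : {poly F}) (x : F) :
  [pchar F] =i pred0 -> N != 0 -> root N x -> ~~ root g x ->
  mup x (N^`() * g + N * h) = (mup x N).-1.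
Proof.
move=> F0 N0 Nx gx.
have [[|m] [q]] := multiplicity_XsubC N x; rewrite N0 /= => qx eN.
  by move: Nx qx; rewrite eN mulr1 => ->.
have mupXn k : mup x (('X - x%:P) ^+ k) = k by rewrite mup_XsubCX eqxx.
(* With [N = q (X - x)^(m+1)], the cofactor takes the value
   [(m+1) q(x) g(x)] at [x], which is nonzero in characteristic zero. *)
have -> : N^`() * g + N * h = ('X - x%:P) ^+ m *
    ((q^`() * g + q * h) * ('X - x%:P) + q * g *+ m.+1).
  rewrite eN derivM deriv_exp derivXsubC mul1r /= exprS.
  rewrite -[_ *+ m.+1]mulr_natr -[_ *+ m.+1 in RHS]mulr_natr; ring.
rewrite mupMl; last first.
  rewrite rootE !hornerE subrr mulr0 add0r hornerMn hornerM -mulr_natr.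
  by rewrite !mulf_neq0 -?rootE // (proj1 (pcharf0P F) F0).
by rewrite eN mupMr // !mupXn.
Qed.

Lemma horner_neq0 (F : fieldType) (f : {poly F}) (z : F) : f.[z] != 0 -> f != 0.
Proof. by apply: contraNneq => ->; rewrite horner0. Qed.

(** When [b] is nonzero at [z], the order of [a / b] at [z] can be read off
    from its numerator [a]. *)
Lemma zero_of_mult_frac (F : fieldType) (a b : {poly F}) (z : F) (r : nat) :
  b.[z] != 0 -> zero_of_mult (a%:F / b%:F) z r <-> a != 0 /\ mup z a = r.
Proof.
move=> bz; split=> [[u [v [u0 vz e <-]]]|[a0 <-]]; last by exists a, b.
move/eqP: e; rewrite eqr_div ?tofrac_eq0 ?(horner_neq0 bz) ?(horner_neq0 vz) //.
rewrite -!tofracM tofrac_eq => /eqP e.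
split.
  apply: contraNneq (mulf_neq0 u0 (horner_neq0 bz)) => a0.
  by rewrite -e a0 mul0r.
by rewrite -(mupMl a (q2 := v)) ?e ?mupMl // rootE.
Qed.

Lemma ratvalue_frac0 (F : fieldType) (a b : {poly F}) (z : F) :
  b.[z] != 0 -> ratvalue (a%:F / b%:F) z 0 -> root a z.
Proof.
move=> bz [u [v [vz e /eqP]]].
rewrite mulf_eq0 invr_eq0 (negPf vz) orbF => /eqP uz.
move/eqP: e; rewrite eqr_div ?tofrac_eq0 ?(horner_neq0 bz) ?(horner_neq0 vz) //.
rewrite -!tofracM tofrac_eq => /eqP.
move/(congr1 (horner^~ z)); rewrite !hornerM uz mul0r => /eqP.
by rewrite mulf_eq0 (negPf vz) orbF rootE.
Qed.

Lemma zero_of_mult_Q_shift (F : fieldType) (f : {poly F}) (s z : F) (r : nat) :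
  let g := f^`() + s *: f in
  [pchar F] =i pred0 -> f.[z] != 0 -> g.[z] != 0 -> ratvalue (Q f) z 0 ->
  zero_of_mult (Q g) z r -> zero_of_mult (Q f) z r.+1.
Proof.
move=> g F0 fz gz.
have sqz (w : {poly F}) : w.[z] != 0 -> (w ^+ 2).[z] != 0.
  by move=> wz; rewrite horner_exp expf_neq0.
rewrite !QE ?(horner_neq0 fz) ?(horner_neq0 gz) // -!/(Qnum _) => /(ratvalue_frac0 (sqz f fz)) Nz.
move=> /(zero_of_mult_frac _ _ (sqz g gz)) [Ng0 <-].
apply/(zero_of_mult_frac _ _ (sqz f fz)).
have E := Qnum_shift f s; rewrite /= -/g in E.
have N0 : Qnum f != 0.
  apply: contraNneq (mulf_neq0 (horner_neq0 fz) Ng0) => N0.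
  by rewrite E N0 deriv0 !mul0r addr0.
split=> //; rewrite -(mupMr (Qnum g) (q1 := f)) ?rootE // E.
by rewrite mup_deriv_comb ?rootE // prednK // -XsubC_dvd // dvdp_XsubCl.
Qed.

Theorem theorem2p1 (R : realType) (p : {poly R}) (sigma : R)
    (lambda : R[i]) (r : nat) (hr : (1 <= r)%N)
    (hQps : zero_of_mult (Q (cpoly (psigma p sigma))) lambda r)
    (hp : (cpoly p).[lambda] != 0)
    (hp' : (cpoly p^`()).[lambda] != 0)
    (hps : (cpoly (psigma p sigma)).[lambda] != 0)
    (hQp : ratvalue (Q (cpoly p)) lambda 0) :
  zero_of_mult (Q (cpoly p)) lambda r.+1.
Proof.
have e : cpoly (psigma p sigma) =
    (cpoly p)^`() + real_complex R sigma *: cpoly p.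
  by rewrite /cpoly /psigma rmorphD /= map_polyZ deriv_map.
move: hQps hps; rewrite e => hQps hps.
exact: zero_of_mult_Q_shift (@Num.Theory.pchar_num _) hp hps hQp hQps.
Qed.
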